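(* Let $\mathbb R^d$ be equipped with the Euclidean metric. Let $\mu$ be a probability distribution on $\mathbb R^d$ with a density with respect to Lebesgue measure $\lambda$, and let $\mathcal D=(\mathbf X,\mathbf Y)$ be a finite labeled sample, with labels in $\{1,\dots,M\}$, where the samples in $\mathbf X$ are independently drawn according to $\mu$. Let $\mathcal D'=(\mathbf X',\mathbf Y')$ be any (nonempty) subset of $\mathcal D$. If $\mathcal D'$ contains at least two instance-label pairs with different labels, let $$\widetilde{\mathcal D}=\mathcal D'\setminus\{(X',Y')\in\mathcal D' : Y'(Q')=Y' \text{ for all } Q'\in\mathcal N(X';\mathbf X')\},$$ and otherwise let $\widetilde{\mathcal D}=\{(X'_1,Y'_1)\}$. Then, with probability one over $\mathcal D$, for $\lambda$-almost all $x\in\mathbb R^d$, $$Y^{(1)}(x;\widetilde{\mathcal D})=Y^{(1)}(x;\mathcal D').$$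
   Context: For a finite indexed set of points $\mathbf X'=\{X'_1,\dots,X'_m\}\subset\mathbb R^d$ and $x\in\mathbb R^d$, $X^{(i)}(x;\mathbf X')$ denotes the $i$th nearest neighbor of $x$ in $\mathbf X'$ (Euclidean distance, ties broken towards the smaller index). For a labeled set $\mathcal D'=(\mathbf X',\mathbf Y')=\{(X'_i,Y'_i)\}$ with distinct instances, $Y'(X')$ is the label in $\mathcal D'$ of $X'\in\mathbf X'$, and $Y^{(1)}(x;\mathcal D')$ is the label paired with the nearest neighbor $X^{(1)}(x;\mathbf X')$; the same notation is used for $\widetilde{\mathcal D}\subseteq\mathcal D'$, with indices inherited. The Voronoi cell of $X'\in\mathbf X'$ is $V_{X'}(\mathbf X')=\{x:X^{(1)}(x;\mathbf X')=X'\}$, and the set of neighbors of $X'$ in $\mathbf X'$ is $$\mathcal N(X';\mathbf X')=\{Q'\in\mathbf X':\exists x\in V_{X'}(\mathbf X')\text{ such that }Q'=X^{(2)}(x;\mathbf X')\}.$$ The instances of $\mathcal D$ are almost surely distinct, since $\mu$ has a density. $(X'_1,Y'_1)$ is the pair with index 1 in $\mathcal D'$. *)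

(* Defs.v *)
(* MathComp / MathComp-Analysis. *)
From HB Require Import structures.
From mathcomp Require Import all_boot all_order all_algebra.
From mathcomp Require Import all_classical all_reals all_analysis.

Set Implicit Arguments.
Unset Strict Implicit.
Unset Printing Implicit Defensive.

Import Order.TTheory GRing.Theory Num.Theory.
Import numFieldNormedType.Exports.

Local Open Scope classical_set_scope.
Local Open Scope ring_scope.

(* Tuples rather than ['rV[R]_d]: tuples carry the product of the Borel
   sigma-algebras in the library, whereas row vectors have no measurable
   structure and are normed by the sup norm. *)
Notation Rd R d := (d.-tuple (measurableTypeR R)).

Section lebesgue_measure_Rd.
Context {R : realType}.

Definition tcons n (p : measurableTypeR R * Rd R n) : Rd R n.+1 :=
  [tuple of p.1 :: p.2].

Lemma measurable_tcons n : measurable_fun setT (@tcons n).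
Proof. exact: measurable_cons. Qed.

Section step.
Context n (mu : {sigma_finite_measure set (Rd R n) -> \bar R}).

Definition lebesgue_step : set (Rd R n.+1) -> \bar R :=
  pushforward (lebesgue_measure \x mu)%E (@tcons n).

Let lebesgue_step0 : lebesgue_step set0 = 0%E.
Proof. by rewrite /lebesgue_step /pushforward preimage_set0 measure0. Qed.

Let lebesgue_step_ge0 A : (0 <= lebesgue_step A)%E.
Proof. by rewrite /lebesgue_step /pushforward measure_ge0. Qed.

Let lebesgue_step_sigma_additive : semi_sigma_additive lebesgue_step.
Proof.
move=> F mF tF mUF; rewrite /lebesgue_step /pushforward preimage_bigcup.
have mh (A : set (Rd R n.+1)) : measurable A -> measurable (@tcons n @^-1` A).
  by move=> mA; rewrite -[X in measurable X]setTI; exact: measurable_tcons.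
apply: measure_semi_sigma_additive => [i|/=|].
- exact: mh (mF i).
- apply/trivIsetP => i j _ _ ij; rewrite -preimage_setI.
  by move/trivIsetP : tF => /(_ _ _ I I ij) ->; rewrite preimage_set0.
- by rewrite -preimage_bigcup; exact: mh.
Qed.

HB.instance Definition _ := isMeasure.Build _ _ _ lebesgue_step
  lebesgue_step0 lebesgue_step_ge0 lebesgue_step_sigma_additive.

Let lebesgue_step_sigma_finite : sigma_finite setT lebesgue_step.
Proof.
have /sigma_finiteP[F [TF ndF Foo]] := sigma_finiteT (@lebesgue_measure R).
have /sigma_finiteP[G [TG ndG Goo]] := sigma_finiteT mu.
pose h (t : Rd R n.+1) : measurableTypeR R * Rd R n :=
  (thead t, [tuple of behead t]).
have Kh : cancel (@tcons n) h by move=> [x t]; congr pair; exact/val_inj.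
have mh : measurable_fun setT h.
  apply: measurable_fun_pair.
    exact: measurable_tnth.
  exact: measurable_behead.
exists (fun i => h @^-1` (F i `*` G i)).
  apply/seteqP; split=> // t _.
  have [i _ Fi] : (\bigcup_i F i) (h t).1 by rewrite -TF.
  have [j _ Gj] : (\bigcup_i G i) (h t).2 by rewrite -TG.
  exists (maxn i j) => //; split.
    by apply: (subsetPset _ _ (ndF _ _ (leq_maxl i j))).
  by apply: (subsetPset _ _ (ndG _ _ (leq_maxr i j))).
move=> i; have [mF Fioo] := Foo i; have [mG Gioo] := Goo i; split.
  by rewrite -[X in measurable X]setTI; apply: mh => //; exact: measurableX.
rewrite /lebesgue_step /pushforward (_ : _ @^-1` _ = F i `*` G i); last first.
  by apply/seteqP; split => p; rewrite /preimage/mkset Kh.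
by rewrite product_measure1E// lte_mul_pinfty// ge0_fin_numE.
Qed.

HB.instance Definition _ := Measure_isSigmaFinite.Build _ _ _ lebesgue_step
  lebesgue_step_sigma_finite.

End step.

Fixpoint lebesgue_Rd d : {sigma_finite_measure set (Rd R d) -> \bar R} :=
  match d with
  | 0 => \d_[tuple]
  | d'.+1 => lebesgue_step (lebesgue_Rd d')
  end.

Lemma lebesgue_Rd_box d (B : 'I_d -> set (measurableTypeR R)) :
  (forall i, measurable (B i)) ->
  lebesgue_Rd d [set x | forall i, B i (tnth x i)] =
  (\prod_(i < d) lebesgue_measure (B i))%E.
Proof.
elim: d B => [|d IH] B mB.
  by rewrite big_ord0 /= diracE mem_set//= => -[].
rewrite big_ord_recl -IH//.
rewrite /= /lebesgue_step /pushforward.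
rewrite -product_measure1E//; last first.
  rewrite (_ : mkset _ = \bigcap_(i in [set: 'I_d])
     (fun x : Rd R d => tnth x i) @^-1` B (lift ord0 i)); last first.
    by apply/seteqP; split => x /= h i; [move=> _|]; apply: h.
  apply: fin_bigcap_measurable => // i _.
  by rewrite -[X in measurable X]setTI; exact: measurable_tnth.
congr (_ _); apply/seteqP; split => -[a t] /=.
  move=> h; split; first exact: (h ord0).
  by move=> i; have := h (lift ord0 i); rewrite tnthS.
move=> [h0 h] i; case: (unliftP ord0 i) => [j|] ->//.
by rewrite tnthS; exact: h.
Qed.

End lebesgue_measure_Rd.

Definition has_density (R : realType) d (mu : probability (Rd R d) R) :=
  exists f : Rd R d -> R,
    [/\ measurable_fun setT f, (forall x, 0 <= f x) &
      forall A, measurable A ->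
        mu A = (\int[lebesgue_Rd d]_(x in A) (f x)%:E)%E].

Definition mutually_independent disp (Omega : measurableType disp)
    (R : realType) (P : probability Omega R) disp' (T : measurableType disp')
    n (X : 'I_n -> {RV P >-> T}) :=
  forall (J : {set 'I_n}) (B : 'I_n -> set T), (forall i, measurable (B i)) ->
    P (\bigcap_(i in [set` J]) X i @^-1` B i) =
    (\prod_(i in J) P (X i @^-1` B i))%E.

Definition edist (R : realType) d (x y : Rd R d) : R :=
  Num.sqrt (\sum_(i < d) (tnth x i - tnth y i) ^+ 2).

(* A finite indexed set of points is a family [X : 'I_m -> R^d], and its subsets
   are given by their sets of indices [A : {set 'I_m}], so that indices are
   inherited.  Points are referred to by their indices, which is unambiguous
   as soon as the points are distinct. *)
Section nearest_neighbors.
Context {R : realType} {d m : nat} (X : 'I_m -> Rd R d).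
Implicit Types (A : {set 'I_m}) (x : Rd R d).

Definition closer x : rel 'I_m := fun i j =>
  (edist x (X i) < edist x (X j)) ||
  (edist x (X i) == edist x (X j)) && (i <= j)%N.

(* The neighbors are numbered from 1; the result is [None] if [A] has fewer
   than [k] elements. *)
Definition nearest k x A : option 'I_m := onth (sort (closer x) (enum A)) k.-1.

Definition voronoi i A : set (Rd R d) := [set x | nearest 1 x A = Some i].

Definition neighbors i A : set 'I_m :=
  [set q | exists2 x, voronoi i A x & nearest 2 x A = Some q].

Context {M : nat} (Y : 'I_m -> 'I_M).

Definition nearest_label x A : option 'I_M := omap Y (nearest 1 x A).

End nearest_neighbors.

(* The family is indexed by ['I_m.+1], so that it is nonempty and its first
   element has index [ord0]. *)
Definition condensed (R : realType) d m M (X : 'I_m.+1 -> Rd R d)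
    (Y : 'I_m.+1 -> 'I_M) : {set 'I_m.+1} :=
  if [exists i, exists j, Y i != Y j] then
    ~: [set i | `[< forall q, neighbors X i [set: 'I_m.+1]%SET q -> Y q = Y i >]]
  else [set ord0]%SET.

(* Main.v *)
Require Import Defs.
From mathcomp Require Import all_boot all_order all_algebra.
From mathcomp Require Import all_classical all_reals all_analysis.
From mathcomp Require Import ring lra measurable_realfun.

Set Implicit Arguments.
Unset Strict Implicit.
Unset Printing Implicit Defensive.

Import Order.TTheory GRing.Theory Num.Theory.
Import numFieldNormedType.Exports.

Local Open Scope classical_set_scope.
Local Open Scope ring_scope.

(* Let [i] be the nearest neighbor of [x] and [j] its nearest neighbor among the
   retained points, and suppose that [Y j != Y i].  By the intermediate value
   theorem the segment from [x] to [X j] contains a point [z] whose distance [r]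
   to the points labeled [Y i] equals its distance to the other points.  Among
   the points at distance [r] from [z], choose [p] labeled [Y i] and [q] labeled
   differently with [X p] and [X q] as close as possible.  The ball with diameter
   [X p, X q] then contains no third point at distance [r] from [z], so moving
   [z] slightly towards the midpoint, and then a little towards [X p], gives a
   point whose first and second neighbors are [p] and [q]: hence [p] is retained.
   Since [z] is on the segment and [X p] is at least as close to [z] as [X j],
   [X p] is at least as close to [x] as [X j].  This forces a tie between [p] and
   [j], which happens only for [x] on a bisector of two sample points, that is on
   a null set as the sample points are almost surely distinct. *)

(** * Pairs of neighbors across a label boundary *)

Section frontier.
Context {R : realType} {d : nat}.
Implicit Types u v w x y z : 'rV[R]_d.

Definition dot u v : R := \sum_(i < d) u 0 i * v 0 i.

Definition dist2 x y : R := dot (x - y) (x - y).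

Lemma dotC u v : dot u v = dot v u.
Proof. by apply: eq_bigr => i _; rewrite mulrC. Qed.

Lemma dotDl u v w : dot (u + v) w = dot u w + dot v w.
Proof. by rewrite -big_split; apply: eq_bigr => i _; rewrite mxE mulrDl. Qed.

Lemma dotZl k u v : dot (k *: u) v = k * dot u v.
Proof. by rewrite mulr_sumr; apply: eq_bigr => i _; rewrite mxE mulrA. Qed.

Lemma dotNl u v : dot (- u) v = - dot u v.
Proof. by rewrite -scaleN1r dotZl mulN1r. Qed.

Lemma dotDr u v w : dot w (u + v) = dot w u + dot w v.
Proof. by rewrite ![dot w _]dotC dotDl. Qed.

Lemma dotZr k u v : dot v (k *: u) = k * dot v u.
Proof. by rewrite ![dot v _]dotC dotZl. Qed.

Lemma dotNr u v : dot v (- u) = - dot v u.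
Proof. by rewrite ![dot v _]dotC dotNl. Qed.

Definition dotE := (dotDl, dotDr, dotNl, dotNr, dotZl, dotZr).

Lemma dot_ge0 u : 0 <= dot u u.
Proof. by apply: sumr_ge0 => i _; rewrite -expr2 sqr_ge0. Qed.

Lemma dot_eq0 u : (dot u u == 0) = (u == 0).
Proof.
apply/idP/eqP => [|->]; last first.
  by rewrite /dot big1// => i _; rewrite mxE mul0r.
rewrite psumr_eq0 => [/allP u0|i _]; last by rewrite -expr2 sqr_ge0.
apply/rowP => i; rewrite mxE; apply/eqP.
by have := u0 i (mem_index_enum i); rewrite mulf_eq0 orbb.
Qed.

Lemma dist2_gt0 x y : (0 < dist2 x y) = (x != y).
Proof. by rewrite lt_def dot_ge0 andbT dot_eq0 subr_eq0. Qed.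

(** Finitely many strict inequalities survive a small move: [e * (|b i| + 1) <= a i] keeps the loss
    [e * |b i|] below [a i]. The default [1] of the minimum covers an empty [I]. *)
Lemma pos_perturbation (I : finType) (a b : I -> R) :
  (forall i, 0 < a i) -> exists2 e, 0 < e & forall i, 0 < a i + e * b i.
Proof.
move=> a0; pose e := \big[Num.min/1]_(i : I) (a i / (`|b i| + 1)).
have b0 i : 0 < `|b i| + 1 by rewrite ltr_wpDl.
have e0 : 0 < e.
  rewrite /e; elim/big_ind: _ => // [u v u0 v0|i _].
    by rewrite lt_min u0.
  by rewrite divr_gt0.
exists e => // i.
have le_e : e <= a i / (`|b i| + 1) by exact: bigmin_le_cond.
have : e * (`|b i| + 1) <= a i by rewrite -ler_pdivlMr.
have : - (e * `|b i|) <= e * b i.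
  by rewrite -mulrN ler_pM2l// lerNl -normrN ler_norm.
by rewrite mulrDr mulr1; lra.
Qed.

Lemma continuous_bigmin (I : finType) (P : pred I) (F0 : R -> R)
    (F : I -> R -> R) : continuous F0 -> (forall i, continuous (F i)) ->
  continuous (fun t => \big[Num.min/F0 t]_(i | P i) F i t).
Proof.
move=> cF0 cF; elim: (index_enum I) => [|i s IH].
  by under eq_fun do rewrite big_nil.
under eq_fun do rewrite big_cons; case: (P i) => // t.
exact: continuous_min (cF i t) (IH t).
Qed.

Section points.
Context {I : finType} (a : I -> 'rV[R]_d) (c : pred I).

Let rest := [pred i | ~~ c i].

(** The default value is one of the terms as soon as [P i0], so the minimum is then attained on
    [P]. *)
Let mindist (P : pred I) (i0 : I) y : R :=
  \big[Num.min/dist2 y (a i0)]_(i | P i) dist2 y (a i).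

Let mindist_le (P : pred I) i0 y i : P i -> mindist P i0 y <= dist2 y (a i).
Proof. by move=> Pi; exact: bigmin_le_cond. Qed.

Let mindist_attained (P : pred I) i0 y :
  P i0 -> exists2 i, P i & dist2 y (a i) = mindist P i0 y.
Proof.
move=> Pi0; have /bigmin_leP := lexx (mindist P i0 y).
case=> [le0|[i Pi lei]]; [exists i0|exists i] => //;
  by apply/eqP; rewrite eq_le mindist_le ?andbT.
Qed.

(** The last clause covers every [p] of class [c] at squared distance [r], because the one to be
    retained is chosen only later, by [frontier_pair]. *)
Lemma equidistant_point p0 j x : injective a -> c p0 -> ~~ c j ->
    (forall i, ~~ c i -> dist2 x (a p0) <= dist2 x (a i)) ->
  exists z r, [/\ forall i, r <= dist2 z (a i),
    exists2 p, c p & dist2 z (a p) = r,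
    exists2 q, ~~ c q & dist2 z (a q) = r &
    forall p, c p -> dist2 z (a p) = r -> dist2 x (a p) <= dist2 x (a j)].
Proof.
move=> inj_a cp0 cj near_p0.
pose z t := x + t *: (a j - x).
pose f t := mindist c p0 (z t) - mindist rest j (z t).
have cd i : continuous (fun t => dist2 (z t) (a i)).
  have -> : (fun t => dist2 (z t) (a i)) = (fun t => (dist2 x (a i) +
      t * (2 * dot (a j - x) (x - a i))) + t * t * dot (a j - x) (a j - x)).
    apply/funext => t; rewrite /dist2 /z !dotE.
    rewrite (dotC (a j) x) (dotC (a i) x) (dotC (a i) (a j)); ring.
  move=> t.
  apply: cvgD; first apply: cvgD; first exact: cvg_cst.
    by apply: cvgM; [exact: cvg_id|exact: cvg_cst].
  apply: cvgM; last exact: cvg_cst.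
  by apply: cvgM; exact: cvg_id.
have cf : continuous f.
  by move=> t; apply: cvgB; exact: continuous_bigmin.
have f0 : f 0 <= 0.
  rewrite /f subr_le0; have -> : z 0 = x by rewrite /z scale0r addr0.
  have [i ci <-] := @mindist_attained rest j x cj.
  by rewrite (le_trans _ (near_p0 i ci))// mindist_le.
have z1 : z 1 = a j by rewrite /z scale1r addrC subrK.
have dj : dist2 (a j) (a j) = 0 by apply/eqP; rewrite dot_eq0 subrr.
have f1 : 0 <= f 1.
  rewrite /f z1 subr_ge0 (le_trans (@mindist_le rest j _ j cj))// dj.
  have [i _ <-] := @mindist_attained c p0 (a j) cp0; exact: dot_ge0.
have [|t] := @IVT _ f 0 1 0 ler01 (continuous_subspaceT cf).
  by rewrite ge_min le_max f0 f1 orbT.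
rewrite in_itv/= => /andP[t0 t1] /eqP; rewrite subr_eq0 => /eqP ft.
exists (z t), (mindist c p0 (z t)); split.
- by move=> i; case ci: (c i); [|rewrite ft]; rewrite mindist_le//= ci.
- exact: mindist_attained.
- by have [q cq dq] := @mindist_attained rest j (z t) cj; exists q; rewrite ?ft.
move=> p cp dp.
have le_pj : dist2 (z t) (a p) <= dist2 (z t) (a j).
  by rewrite dp ft mindist_le.
have pj : a p != a j by apply: contraNneq cj => /inj_a <-.
(* The difference of the squared distances to two points is affine. *)
have aff : dist2 (z t) (a p) - dist2 (z t) (a j) =
    (1 - t) * (dist2 x (a p) - dist2 x (a j)) + t * dist2 (a p) (a j).
  rewrite /dist2 /z !dotE.
  rewrite (dotC (a j) x) (dotC (a p) x) (dotC (a p) (a j)); ring.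
have pj0 : 0 < dist2 (a p) (a j) by rewrite dist2_gt0.
(* If [a p] were farther from [x] than [a j], the right side of [aff] would be positive: through its
   first term when [t < 1], through [pj0] when [t = 1]. *)
rewrite -subr_le0 leNgt; apply/negP => lt_jp.
move: le_pj; rewrite -subr_le0 aff leNgt => /negP; apply.
by case: (ltrgtP t 1) t1 => // [t1 _|-> _]; nra.
Qed.

(* Gabriel's condition: if [q] is not second, the ball with diameter [a p, a q]
   contains a tied [a i], which is closer than [a q] to [a p] and closer than
   [a p] to [a q], and replacing [p] or [q] by [i] contradicts minimality. *)
Lemma frontier_pair p0 q0 z r : injective a -> c p0 -> ~~ c q0 ->
    dist2 z (a p0) = r -> dist2 z (a q0) = r ->
    (forall i, r <= dist2 z (a i)) ->
  exists p q w, [/\ c p, ~~ c q, dist2 z (a p) = r,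
    dist2 w (a p) < dist2 w (a q) &
    forall i, i != p -> i != q -> dist2 w (a q) < dist2 w (a i)].
Proof.
move=> inj_a cp0 cq0 dp0 dq0 rmin.
pose good (k : I * I) := [&& c k.1, ~~ c k.2, dist2 z (a k.1) == r
  & dist2 z (a k.2) == r].
have good0 : good (p0, q0) by rewrite /good cp0 cq0 dp0 dq0 eqxx.
case: (arg_minP (fun k => dist2 (a k.1) (a k.2)) good0) => -[p q].
rewrite /good/= => /and4P[cp cq /eqP dp /eqP dq] minpq.
(* With [z] as origin, tied points lie on one sphere, and comparing their mutual distances amounts
   to comparing dot products. *)
have [b bE] : exists b : I -> 'rV_d, forall i, a i = b i + z.
  by exists (fun i => a i - z) => i; rewrite subrK.
have bb i : dot (b i) (b i) = dist2 z (a i).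
  by rewrite /dist2 bE opprD addrCA subrr addr0 dotNl dotNr opprK.
have dE i j : dist2 (a i) (a j) =
    dist2 z (a i) + dist2 z (a j) - 2 * dot (b i) (b j).
  rewrite -!bb /dist2 !bE opprD addrACA subrr addr0.
  by rewrite !dotE (dotC (b j) (b i)); ring.
have neq i j : i != j -> 0 < dist2 (a i) (a j).
  by move=> ij; rewrite dist2_gt0 (inj_eq inj_a).
(* For tied [i] this is the dot product of [b p - b i] and [b q - b i], positive exactly when [a i]
   is outside the ball with diameter [a p, a q]. In this form it says that moving [z] along
   [b p + b q] favors [q] over [i]. *)
have gab i : i != p -> i != q -> dist2 z (a i) = r ->
    0 < dot (b p + b q) (b q - b i).
  move=> ip iq di.
  rewrite !dotE bb dq.
  case ci: (c i).
    have := minpq (i, q); rewrite ci cq di dq eqxx/= => /(_ isT).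
    have := neq _ _ ip; rewrite !dE dp dq di (dotC (b i) (b p)) (dotC (b i) (b q)).
    by lra.
  have := minpq (p, i); rewrite ci cp di dp eqxx/= => /(_ isT).
  have := neq _ _ iq; rewrite !dE dp dq di (dotC (b i) (b q)).
  by lra.
pose tied i := [&& i != p, i != q & dist2 z (a i) == r].
have pq : p != q by apply: contraNneq cq => <-.
(* As [p] and [q] are tied, [b p + b q] is orthogonal to [b p - b q]. Adding a small multiple of the
   latter puts [p] before [q] without spoiling [gab]. *)
have [v v0 Hv] : exists2 v, 0 < dot v (b p - b q) &
    forall i, tied i -> 0 < dot v (b q - b i).
  pose g i := if tied i then dot (b p + b q) (b q - b i) else 1.
  have g0 i : 0 < g i.
    by rewrite /g; case: ifP => // /and3P[ip iq /eqP]; exact: gab.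
  have [e e0 He] := pos_perturbation (fun i => dot (b p - b q) (b q - b i)) g0.
  exists (b p + b q + e *: (b p - b q)) => [|i ti].
    have := neq _ _ pq; rewrite dE dp dq => pq0.
    rewrite !dotE !bb dp dq (dotC (b q) (b p)).
    rewrite [ltRHS](_ : _ = e * (r + r - 2 * dot (b p) (b q))); last by ring.
    by rewrite mulr_gt0.
  by move: (He i); rewrite /g ti => Hi; rewrite dotDl dotZl.
(* Untied points have a positive gap, which a small step [h] preserves; tied ones get a dummy [1],
   since [Hv] handles them. *)
pose g i := if dist2 z (a i) == r then 1 else dist2 z (a i) - r.
have g0 i : 0 < g i.
  by rewrite /g; case: eqVneq => // di; rewrite subr_gt0 lt_neqAle eq_sym di rmin.
have [h h0 Hh] := pos_perturbation (fun i => 2 * dot v (b q - b i)) g0.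
have dw i k : dist2 (z + h *: v) (a i) - dist2 (z + h *: v) (a k) =
    dist2 z (a i) - dist2 z (a k) + h * (2 * dot v (b k - b i)).
  have dwE l : dist2 (z + h *: v) (a l) =
      dist2 z (a l) + h * h * dot v v - 2 * h * dot v (b l).
    rewrite -bb /dist2 bE (addrC (b l)) opprD addrACA subrr add0r.
    by rewrite !dotE (dotC (b l)); ring.
  by rewrite !dwE dotDr dotNr; ring.
exists p, q, (z + h *: v); split => // [|i ip iq].
  by rewrite -subr_gt0 dw dp dq subrr add0r !pmulr_rgt0.
rewrite -subr_gt0 dw dq.
have := Hh i; rewrite /g; case: eqVneq => // di _.
by rewrite di subrr add0r !pmulr_rgt0// Hv// /tied ip iq di eqxx.
Qed.

End points.
End frontier.

(** * Nearest neighbors *)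

(* [Defs.edist] is qualified because [edist] is the extended distance of
   MathComp-Analysis. *)
Section nearest_theory.
Context {R : realType} {d m : nat} (X : 'I_m -> Rd R d).
Implicit Types (A : {set 'I_m}) (x : Rd R d).

Lemma closer_total x : total (closer X x).
Proof.
by move=> i j; rewrite /closer; case: ltgtP => //= _; exact: leq_total.
Qed.

Lemma closer_trans x : transitive (closer X x).
Proof.
move=> j i k; rewrite /closer.
case: ltgtP => //= [ij _|-> ij].
  by case: ltgtP => //= [jk|<-] _; rewrite ?ij// (lt_trans ij jk).
by case: ltgtP => //= _; exact: leq_trans.
Qed.

Lemma closer_anti x : antisymmetric (closer X x).
Proof.
move=> i j; rewrite /closer; case: ltgtP => //= _.
by rewrite -eqn_leq => /eqP/val_inj.
Qed.

Lemma closer_edist x i j : closer X x i j -> Defs.edist x (X i) <= Defs.edist x (X j).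
Proof. by move=> /orP[/ltW|/andP[/eqP->]]. Qed.

Lemma nearest1_Some x A i :
  nearest X 1 x A = Some i -> i \in A /\ (forall j, j \in A -> closer X x i j).
Proof.
rewrite /nearest/=; have := sort_sorted (@closer_total x) (enum A).
have memA j : (j \in sort (closer X x) (enum A)) = (j \in A).
  by rewrite mem_sort mem_enum.
case: sort memA => // k s memA /= /(order_path_min (@closer_trans x))/allP ks [<-].
split=> [|j]; first by rewrite -memA mem_head.
rewrite -memA inE => /predU1P[->|/ks//].
by have := closer_total x k k; rewrite orbb.
Qed.

Lemma nearest1_neq0 x A i : i \in A -> exists j, nearest X 1 x A = Some j.
Proof.
rewrite -mem_enum -(mem_sort (closer X x)) /nearest/=.
by case: sort => // j s _; exists j.
Qed.

(** The index tie-break makes [closer x] a total order, so the sorted list of indices is unique and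
    it suffices to exhibit one that starts with [p] and [q]. *)
Lemma nearest12_strict x p q : Defs.edist x (X p) < Defs.edist x (X q) ->
    (forall i, i != p -> i != q -> Defs.edist x (X q) < Defs.edist x (X i)) ->
  nearest X 1 x [set: 'I_m]%SET = Some p /\
  nearest X 2 x [set: 'I_m]%SET = Some q.
Proof.
move=> pq qs; pose s := rem q (rem p (enum [set: 'I_m]%SET)).
have uE : uniq (enum [set: 'I_m]%SET) by exact: enum_uniq.
have memE i : i \in enum [set: 'I_m]%SET by rewrite mem_enum inE.
have qp : q != p by apply: contraTneq pq => ->; rewrite ltxx.
have sortE : sort (closer X x) (enum [set: 'I_m]%SET) =
    p :: q :: sort (closer X x) s.
  apply: (sorted_eq (@closer_trans x) (@closer_anti x)).
  - exact: sort_sorted (@closer_total x) _.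
  - rewrite /= {1}/closer pq/= path_min_sorted ?(sort_sorted (@closer_total x))//.
    apply/allP => i; rewrite mem_sort /s !mem_rem_uniq ?rem_uniq// !inE.
    rewrite mem_rem_uniq// !inE.
    by move=> /and3P[iq ip _]; rewrite /closer qs.
  rewrite perm_sort; apply: perm_trans (perm_to_rem (memE p)) _.
  rewrite perm_cons; apply: perm_trans (perm_to_rem _) _.
    by rewrite mem_rem_uniq//; apply/andP; split; [exact: qp|exact: memE].
  by rewrite perm_cons perm_sym perm_sort.
by rewrite /nearest sortE.
Qed.

End nearest_theory.

(** * Null sets *)

Section null_sets.
Context {R : realType}.

Lemma measurable_fun_affine d (a : 'I_d -> R) (b : R) :
  measurable_fun [set: Rd R d] (fun x => \sum_(i < d) a i * tnth x i - b).
Proof.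
apply: measurable_funB => //; apply: measurable_sum => i.
by apply: measurable_funM => //; exact: measurable_tnth.
Qed.

Lemma measurable_hyperplane d (a : 'I_d -> R) (b : R) :
  measurable [set x : Rd R d | \sum_(i < d) a i * tnth x i = b].
Proof.
rewrite [X in measurable X](_ : _ = setT `&`
    (fun x : Rd R d => \sum_(i < d) a i * tnth x i - b) @^-1` [set 0]).
  by apply: measurable_fun_affine => //; exact: measurable_set1.
rewrite setTI; apply/seteqP; split => x /=; first by move=> ->; rewrite subrr.
by move/eqP; rewrite subr_eq0 => /eqP.
Qed.

(** Fubini and induction on the dimension: if a coefficient after the first is nonzero, each slice
    at a fixed first coordinate is a hyperplane; otherwise the set is a point times the whole
    space. *)
Lemma hyperplane_null d (a : 'I_d -> R) (b : R) : (exists i, a i != 0) ->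
  lebesgue_Rd d [set x : Rd R d | \sum_(i < d) a i * tnth x i = b] = 0%E.
Proof.
elim: d a b => [|d IH] a b [i0 ai0]; first by case: i0 ai0.
rewrite /= /lebesgue_step /pushforward.
have tconsE (y : measurableTypeR R) (t : Rd R d) :
    \sum_(i < d.+1) a i * tnth (tcons (y, t)) i =
    a ord0 * y + \sum_(i < d) a (lift ord0 i) * tnth t i.
  rewrite big_ord_recl; congr (_ + _).
  by apply: eq_bigr => i _; rewrite tnthS.
have [[i ai]|] := pselect (exists i, a (lift ord0 i) != 0).
  rewrite [LHS]integral0_eq// => y _ /=.
  rewrite -[RHS](IH (fun i => a (lift ord0 i)) (b - a ord0 * y)); last by exists i.
  congr (lebesgue_Rd d _); apply/seteqP; split => t; rewrite /xsection/= inE/= tconsE.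
    by move=> <-; rewrite addrC addKr.
  by move=> ->; rewrite addrC subrK.
move=> /forallNP a'0.
have {}a'0 i : a (lift ord0 i) = 0 by apply/eqP/negP => /negP; exact: a'0.
have a0 : a ord0 != 0.
  by case: (unliftP ord0 i0) ai0 => [j ->|-> //]; rewrite a'0 eqxx.
rewrite [X in (_ \x _)%E X](_ : _ = [set b / a ord0] `*` setT).
  have m1 : measurable [set b / a ord0 : measurableTypeR R].
    exact: measurable_set1.
  rewrite product_measure1E//.
  by rewrite [X in (X * _)%E](lebesgue_measure_set1 (b / a ord0)) mul0e.
apply/seteqP; split => -[y t] /=; rewrite tconsE big1 ?addr0; try by
  move=> i _; rewrite a'0 mul0r.
  by move=> <-; split=> //; rewrite mulrAC mulfV// mul1r.
by move=> [-> _]; rewrite mulrCA mulfV// mulr1.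
Qed.

Lemma measurable_point d (x : Rd R d) : measurable [set x].
Proof.
rewrite [X in measurable X](_ : _ = \bigcap_(i in [set: 'I_d])
    (fun y : Rd R d => tnth y i) @^-1` [set tnth x i]).
  apply: fin_bigcap_measurable => // i _.
  by rewrite -[X in measurable X]setTI; apply: measurable_tnth => //; exact: measurable_set1.
apply/seteqP; split => [y -> //|y yx].
by apply: eq_from_tnth => i; exact: yx.
Qed.

(** A point is a box with sides of length zero, hence Lebesgue null once there is a coordinate. *)
Lemma density_point_null d (mu : probability (Rd R d) R) (x : Rd R d) :
  (0 < d)%N -> has_density mu -> mu [set x] = 0%E.
Proof.
move=> d0 [f [mf f0 ->]]; last exact: measurable_point.
apply: null_set_integral; first exact: measurable_point.
  by apply/measurable_EFinP; exact: measurable_funTS.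
have -> : [set x] = [set y | forall i, [set tnth x i] (tnth y i)].
  apply/seteqP; split => [y -> //|y yx].
  by apply: eq_from_tnth => i; exact: yx.
apply: etrans (lebesgue_Rd_box (fun i => measurable_set1 (tnth x i))) _.
rewrite (bigD1 (Ordinal d0))//=.
by rewrite [X in (X * _)%E](lebesgue_measure_set1 (tnth x (Ordinal d0))) mul0e.
Qed.

Lemma measurable_diagonal d : measurable [set p : Rd R d * Rd R d | p.1 = p.2].
Proof.
rewrite [X in measurable X](_ : _ = \bigcap_(i in [set: 'I_d])
    (fun p : Rd R d * Rd R d => (tnth p.1 i : measurableTypeR R) - tnth p.2 i) @^-1` [set 0]).
  apply: fin_bigcap_measurable => // i _.
  rewrite -[X in measurable X]setTI.
  have mf : measurable_fun [set: Rd R d * Rd R d]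
      (fun p => tnth p.1 i - tnth p.2 i : measurableTypeR R).
    apply: measurable_funB.
      exact: (measurableT_comp (measurable_tnth i) measurable_fst).
    exact: (measurableT_comp (measurable_tnth i) measurable_snd).
  by apply: mf => //; exact: measurable_set1.
apply/seteqP; split => [[x y]/= -> i _|[x y]/= xy]; first by rewrite /= subrr.
apply: eq_from_tnth => i; apply/eqP; rewrite -subr_eq0; apply/eqP; exact: xy.
Qed.

(** By independence two sample points have joint law [mu \x mu], for which the diagonal is null by
    Fubini, its sections being points. *)
Lemma independent_ae_neq d (mu : probability (Rd R d) R)
    disp (Omega : measurableType disp) (P : probability Omega R) n
    (X : 'I_n -> {RV P >-> Rd R d}) :
    (0 < d)%N -> has_density mu -> mutually_independent X ->
    (forall i A, measurable A -> distribution P (X i) A = mu A) ->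
  {ae P, forall w, forall i j, i != j -> X i w != X j w}.
Proof.
move=> d0 mu_density X_indep X_distr.
apply: filter_forall => i; apply: filter_forall => j.
case: (eqVneq i j) => [_|ij]; first exact: aeW.
have mX (k : 'I_n) : measurable_fun setT (X k) by exact: measurable_funP.
pose XX w := (X i w, X j w).
have mXX : measurable_fun setT XX by exact: measurable_fun_pair.
have mD := @measurable_diagonal d.
have mpre : measurable (XX @^-1` [set p | p.1 = p.2]).
  by rewrite -[X in measurable X]setTI; exact: mXX.
have XXE A B : measurable A -> measurable B ->
    pushforward P XX (A `*` B) = (mu A * mu B)%E.
  move=> mA mB.
  have := X_indep [set i; j]%SET (fun k => if k == i then A else B).
  rewrite big_setU1 ?inE//= big_set1 eqxx eq_sym (negbTE ij).
  rewrite -(X_distr i A mA) -(X_distr j B mB) /distribution /pushforward => <-; last by move=> k; case: ifP.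
  congr (P _); apply/seteqP; split => w /=.
    by move=> [Aw Bw] k /=; rewrite !inE => /orP[]/eqP->; rewrite ?eqxx// eq_sym (negbTE ij).
  move=> H; have := H i; have := H j; rewrite /= !inE !eqxx orbT eq_sym (negbTE ij).
  by move=> /(_ isT) ? /(_ isT).
exists (XX @^-1` [set p | p.1 = p.2]); split => //.
  have := @product_measure_unique _ _ _ _ _ mu mu (pushforward P XX) XXE _ mD.
  move=> /(_ mXX)/esym PD; apply: etrans PD _.
  apply: integral0_eq => x _ /=.
  rewrite -[RHS](density_point_null x d0 mu_density); congr (mu _).
  by apply/seteqP; split => y; rewrite /xsection/= inE.
by move=> w /=; apply: contra_notP => XXw _; apply/eqP.
Qed.

End null_sets.

(** * Condensation *)

Section condensation.
Context {R : realType} {d : nat}.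
Implicit Types x y z : Rd R d.

Definition rowv x : 'rV[R]_d := \row_i tnth x i.

Lemma rowv_inj : injective rowv.
Proof.
move=> x y /rowP xy; apply: eq_from_tnth => i.
by have := xy i; rewrite !mxE.
Qed.

Lemma edistE x y : Defs.edist x y = Num.sqrt (dist2 (rowv x) (rowv y)).
Proof. by congr Num.sqrt; apply: eq_bigr => i _; rewrite !mxE -expr2. Qed.

Lemma le_edist x y z : (Defs.edist x y <= Defs.edist x z) =
  (dist2 (rowv x) (rowv y) <= dist2 (rowv x) (rowv z)).
Proof. by rewrite !edistE ler_psqrt// nnegrE dot_ge0. Qed.

Lemma bisector_null x y : x != y ->
  {ae lebesgue_Rd d, forall z, Defs.edist z x != Defs.edist z y}.
Proof.
(* Subtracting the squared distances of [z] to [x] and [y] cancels the squares of [z] and leaves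
   this affine form. *)
move=> xy; pose a i := 2 * (tnth y i - tnth x i).
pose b := \sum_(i < d) (tnth y i ^+ 2 - tnth x i ^+ 2).
exists [set z : Rd R d | \sum_(i < d) a i * tnth z i = b]; split.
- exact: measurable_hyperplane.
- apply: hyperplane_null; apply/not_existsP => a0.
  move/eqP: xy; apply; apply: eq_from_tnth => i.
  by move/negP: (a0 i); rewrite negbK mulf_eq0 pnatr_eq0/= subr_eq0 => /eqP.
move=> z /= /negP; rewrite negbK => /eqP zxy.
have {}zxy : \sum_(i < d) (tnth z i - tnth x i) ^+ 2 =
    \sum_(i < d) (tnth z i - tnth y i) ^+ 2.
  have s0 u : 0 <= \sum_(i < d) (tnth z i - tnth u i) ^+ 2.
    by apply: sumr_ge0 => i _; exact: sqr_ge0.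
  by rewrite -(sqr_sqrtr (s0 x)) -(sqr_sqrtr (s0 y)); congr (_ ^+ 2).
(* Zero is written as the difference of the two equal sums of squares, so that both sides agree
   coordinate by coordinate. *)
apply/eqP; rewrite -subr_eq0 -[X in _ == X](subrr (\sum_(i < d) (tnth z i - tnth y i) ^+ 2)).
rewrite -[X in _ == X - _]zxy -!sumrB; apply/eqP; apply: eq_bigr => i _.
by rewrite /a; ring.
Qed.

Section deterministic.
Context {m M : nat} (X : 'I_m.+1 -> Rd R d) (Y : 'I_m.+1 -> 'I_M).

(** With class [c] the label of [i], the point [v] lies in the cell of [p] and has second neighbor
    [q] of another label, which prevents the removal of [p]. *)
Lemma condensed_frontier i j x : injective X -> Y j != Y i ->
    (forall k, Y k != Y i -> Defs.edist x (X i) <= Defs.edist x (X k)) ->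
  exists2 p, p \in condensed X Y &
    Y p = Y i /\ Defs.edist x (X p) <= Defs.edist x (X j).
Proof.
move=> inj_X Yji near_i; pose c := [pred k | Y k == Y i].
have inj_a : injective (rowv \o X) := inj_comp rowv_inj inj_X.
have near_i2 k : ~~ c k ->
    dist2 (rowv x) (rowv (X i)) <= dist2 (rowv x) (rowv (X k)).
  by rewrite -le_edist; exact: near_i.
have [z [r [rmin [p0 cp0 dp0] [q0 cq0 dq0] le_xj]]] :=
  equidistant_point (c := c) (p0 := i) (j := j) inj_a (eqxx _) Yji near_i2.
have [p [q [w [cp cq dp pq qs]]]] :=
  frontier_pair inj_a cp0 cq0 dp0 dq0 rmin.
have [v wE] : exists v : Rd R d, w = rowv v.
  exists [tuple w 0 k | k < d]; apply/rowP => k.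
  by rewrite mxE tnth_mktuple.
have [v1 v2] : nearest X 1 v [set: 'I_m.+1]%SET = Some p /\
    nearest X 2 v [set: 'I_m.+1]%SET = Some q.
  by apply: nearest12_strict => [|k kp kq]; rewrite ltNge le_edist -ltNge -wE//; exact: qs.
exists p; last by split; [exact/eqP|rewrite le_edist; exact: le_xj].
rewrite /condensed ifT; last first.
  by apply/existsP; exists j; apply/existsP; exists i.
rewrite inE inE; apply/asboolPn => same; move: cq; rewrite inE.
by rewrite (same q) ?(eqP cp) ?eqxx//; exists v.
Qed.

Lemma nearest_label_condensed x : injective X ->
    (forall i j, i != j -> Defs.edist x (X i) != Defs.edist x (X j)) ->
  nearest_label X Y x (condensed X Y) = nearest_label X Y x [set: 'I_m.+1]%SET.
Proof.
move=> inj_X gen; rewrite /nearest_label.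
have [i xi] := nearest1_neq0 X x (finset.in_setT (ord0 : 'I_m.+1)).
have [_ i_min] := nearest1_Some xi.
have {}i_min k : Defs.edist x (X i) <= Defs.edist x (X k).
  by apply: closer_edist; apply: i_min; rewrite inE.
rewrite xi /=.
have [[j Yji]|same] := pselect (exists j, Y j != Y i); last first.
  have {}same j : Y j = Y i.
    by apply/eqP; apply: contra_notT same => Yji; exists j.
  rewrite /condensed ifF; last first.
    apply/negbTE; rewrite negb_exists; apply/forallP => k.
    rewrite negb_exists; apply/forallP => l.
    by rewrite (same k) (same l) eqxx.
  have [k ->] := nearest1_neq0 X x (set11 (ord0 : 'I_m.+1)).
  by rewrite /= same.
(* This first use only shows that the condensed set is nonempty. *)
have [p0 p0c _] := condensed_frontier inj_X Yji (fun k _ => i_min k).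
have [k xk] := nearest1_neq0 X x p0c.
have [kc k_min] := nearest1_Some xk.
rewrite xk/=; congr Some; apply/eqP; apply/negPn/negP => Yki.
(* Now [j] is [k] itself: the retained [p] is no farther from [x] than [k], which is nearest among
   the retained points, so they tie against [gen]. *)
have [p pc [Ypi le_pk]] := condensed_frontier inj_X Yki (fun k _ => i_min k).
have le_kp := closer_edist (k_min p pc).
have pk : p != k by apply: contraNneq Yki => <-; rewrite Ypi.
by have := gen _ _ pk; rewrite eq_le le_pk le_kp.
Qed.

End deterministic.
End condensation.

Theorem theorem2 (R : realType) (d : nat) (d_gt0 : (0 < d)%N)
  (mu : probability (Rd R d) R) (mu_density : has_density mu)
  (disp : measure_display) (Omega : measurableType disp)
  (P : probability Omega R) (n M : nat)
  (X : 'I_n -> {RV P >-> Rd R d}) (Y : 'I_n -> Omega -> 'I_M)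
  (X_indep : mutually_independent X)
  (X_distr : forall i A, measurable A -> distribution P (X i) A = mu A)
  (Y_meas : forall i y, measurable (Y i @^-1` [set y])) :
  {ae P, forall w, forall (m : nat) (s : 'I_m.+1 -> 'I_n), injective s ->
    let X' i := X (s i) w in
    let Y' i := Y (s i) w in
    {ae lebesgue_Rd d, forall x,
      nearest_label X' Y' x (condensed X' Y') =
      nearest_label X' Y' x [set: 'I_m.+1]%SET}}.
Proof.
(* The exceptional event is a coincidence in the full sample, so one null set serves every [m] and
   [s]. *)
have := independent_ae_neq d_gt0 mu_density X_indep X_distr.
apply: filterS => w Xw m s inj_s; set X' := fun i => X (s i) w.
have inj_X : injective X'.
  move=> i j Xij; apply/eqP; apply: contraTT isT => ij.
  by have := Xw (s i) (s j); rewrite (inj_eq inj_s) ij => /(_ isT)/eqP; case; exact: Xij.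
have gen : {ae lebesgue_Rd d, forall x, forall i j, i != j ->
    Defs.edist x (X' i) != Defs.edist x (X' j)}.
  apply: filter_forall => i; apply: filter_forall => j.
  have [->|ij] := eqVneq i j; first exact: aeW.
  have := @bisector_null _ _ (X' i) (X' j); rewrite (inj_eq inj_X) => /(_ ij).
  exact: filterS.
apply: (filterS _ gen) => x; exact: nearest_label_condensed.
Qed.
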